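(* Let $M$ be a finite-dimensional free $\mathbb{T}$-module of dimension $n$, equipped with a bicomplex scalar product $(\cdot,\cdot)$ that is hyperbolic positive, and let $H:M\to M$ be a bicomplex self-adjoint operator. Then it is always possible to find a set $\{|\phi_l\rangle\}_{l=1}^n$ of eigenkets of $H$ that make up an orthonormal basis of $M$. Moreover, $H$ can be expressed as $$H=\sum_{l=1}^n \lambda_l\,|\phi_l\rangle\langle\phi_l| ,$$ where $\lambda_l\in\mathbb{T}$ is the eigenvalue of $H$ associated with the eigenket $|\phi_l\rangle$.
   Context: Bicomplex numbers: $\mathbb{T}$ is the commutative ring of elements $w=z_1+z_2\mathbf{i_2}$ with $z_1,z_2\in\mathbb{C}(\mathbf{i_1})=\{x+y\mathbf{i_1}: x,y\in\mathbb{R}\}$ (a copy of the complex field), where $\mathbf{i_1}^2=\mathbf{i_2}^2=-1$ and $\mathbf{i_1}\mathbf{i_2}=\mathbf{i_2}\mathbf{i_1}=\mathbf{j}$, so $\mathbf{j}^2=1$. Put $\mathbf{e_1}=(1+\mathbf{j})/2$, $\mathbf{e_2}=(1-\mathbf{j})/2$; then $\mathbf{e_k}^2=\mathbf{e_k}$, $\mathbf{e_1}\mathbf{e_2}=0$, $\mathbf{e_1}+\mathbf{e_2}=1$, and every $w\in\mathbb{T}$ is uniquely $w=\mathbf{e_1}w_{\hat 1}+\mathbf{e_2}w_{\hat 2}$ with $w_{\hat 1},w_{\hat 2}\in\mathbb{C}(\mathbf{i_1})$. The conjugation $\dag_3$ is $w^{\dag_3}=\bar z_1-\bar z_2\mathbf{i_2}$,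 equivalently $w^{\dag_3}=\mathbf{e_1}\overline{w_{\hat 1}}+\mathbf{e_2}\overline{w_{\hat 2}}$. $\mathbb{D}^+=\{\mathbf{e_1}x_1+\mathbf{e_2}x_2: x_1,x_2\in\mathbb{R},\ x_1,x_2\ge 0\}$. A finite-dimensional free $\mathbb{T}$-module is a $\mathbb{T}$-module with a finite basis (linearly independent generating set); its dimension is the number of basis elements; its elements are called kets. A ket $|\psi\rangle$ belongs to the null cone if $\mathbf{e_1}|\psi\rangle=0$ or $\mathbf{e_2}|\psi\rangle=0$ (so $0$ belongs to it). A bicomplex scalar product on $M$ is a map $(\cdot,\cdot):M\times M\to\mathbb{T}$ that is additive and $\mathbb{T}$-homogeneous in the second argument, satisfies $(|\psi\rangle,|\phi\rangle)=(|\phi\rangle,|\psi\rangle)^{\dag_3}$, and $(|\psi\rangle,|\psi\rangle)=0$ iff $|\psi\rangle=0$. It is hyperbolic positive if $(|\psi\rangle,|\psi\rangle)\in\mathbb{D}^+$ for all $|\psi\rangle$. Write $\langle\psi|\phi\rangle=(|\psi\rangle,|\phi\rangle)$; $|\phi\rangle\langle\psi|$ is the operator $|\chi\rangle\mapsto\langle\psi|\chi\rangle\,|\phi\rangle$. A basis $\{|\phi_l\rangle\}$ is orthonormal if $\langle\phi_l|\phi_p\rangle=\delta_{lp}$. A bicomplex linear operator is a $\mathbb{T}$-linear map $A:M\to M$; its adjoint $A^*$ is the unique operator with $(|\psi\rangle,A|\phi\rangle)=(A^*|\psi\rangle,|\phi\rangle)$ for all kets (it always exists). $H$ is self-adjoint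 if $H^*=H$. If $A|\psi\rangle=\lambda|\psi\rangle$ with $\lambda\in\mathbb{T}$ and $|\psi\rangle$ not in the null cone, then $\lambda$ is an eigenvalue and $|\psi\rangle$ an eigenket of $A$ associated with $\lambda$. *)

(* Defs.v *)
From HB Require Import structures.
From mathcomp Require Import all_boot all_order all_algebra.
From mathcomp Require Import reals.
From mathcomp Require Import complex.
From mathcomp Require Import ring.

Set Implicit Arguments.
Unset Strict Implicit.
Unset Printing Implicit Defensive.

Import GRing.Theory.
Local Open Scope ring_scope.
Local Open Scope complex_scope.

(* [Bicomplex z1 z2] stands for z1 + z2 i2, with C(i1) realised as R[i]. *)
Record bicomplex (R : realType) := Bicomplex { bic1 : R[i]; bic2 : R[i] }.

Section BicomplexRing.
Variable R : realType.
Implicit Types u v w : bicomplex R.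

Definition bic_pair w : R[i] * R[i] := (bic1 w, bic2 w).
Definition pair_bic (p : R[i] * R[i]) : bicomplex R := Bicomplex p.1 p.2.

Lemma bic_pairK : cancel bic_pair pair_bic.
Proof. by case. Qed.

HB.instance Definition _ := Choice.copy (bicomplex R) (can_type bic_pairK).

Lemma bic_ext u v : bic1 u = bic1 v -> bic2 u = bic2 v -> u = v.
Proof. by case: u v => [a b] [c d] /= -> ->. Qed.

Definition bic_zero : bicomplex R := Bicomplex 0 0.
Definition bic_one : bicomplex R := Bicomplex 1 0.
Definition bic_opp w := Bicomplex (- bic1 w) (- bic2 w).
Definition bic_add u v := Bicomplex (bic1 u + bic1 v) (bic2 u + bic2 v).
Definition bic_mul u v :=
  Bicomplex (bic1 u * bic1 v - bic2 u * bic2 v)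
            (bic1 u * bic2 v + bic2 u * bic1 v).

Lemma bic_addA : associative bic_add.
Proof. by move=> u v w; apply: bic_ext; rewrite /= addrA. Qed.
Lemma bic_addC : commutative bic_add.
Proof. by move=> u v; apply: bic_ext; rewrite /= addrC. Qed.
Lemma bic_add0 : left_id bic_zero bic_add.
Proof. by move=> u; apply: bic_ext; rewrite /= add0r. Qed.
Lemma bic_addN : left_inverse bic_zero bic_opp bic_add.
Proof. by move=> u; apply: bic_ext; rewrite /= addNr. Qed.

HB.instance Definition _ :=
  GRing.isZmodule.Build (bicomplex R) bic_addA bic_addC bic_add0 bic_addN.

Lemma bic_mulA : associative bic_mul.
Proof. by move=> u v w; apply: bic_ext => /=; ring. Qed.
Lemma bic_mulC : commutative bic_mul.
Proof. by move=> u v; apply: bic_ext => /=; ring. Qed.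
Lemma bic_mul1 : left_id bic_one bic_mul.
Proof. by move=> u; apply: bic_ext => /=; ring. Qed.
Lemma bic_mulD : left_distributive bic_mul bic_add.
Proof. by move=> u v w; apply: bic_ext => /=; ring. Qed.
Lemma bic_one_neq0 : bic_one != 0.
Proof. by apply/eqP => /(congr1 (@bic1 R)) /= /eqP; rewrite oner_eq0. Qed.

HB.instance Definition _ :=
  GRing.Zmodule_isComNzRing.Build (bicomplex R)
    bic_mulA bic_mulC bic_mul1 bic_mulD bic_one_neq0.

Definition bic_of_complex (z : R[i]) : bicomplex R := Bicomplex z 0.
Definition bic_of_real (x : R) : bicomplex R := bic_of_complex x%:C.

Definition bic_i1 : bicomplex R := bic_of_complex 'i.
Definition bic_i2 : bicomplex R := Bicomplex 0 1.
Definition bic_j : bicomplex R := bic_i1 * bic_i2.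
Definition bic_e1 : bicomplex R := bic_of_real 2^-1 * (1 + bic_j).
Definition bic_e2 : bicomplex R := bic_of_real 2^-1 * (1 - bic_j).

Definition dag3 w : bicomplex R := Bicomplex ((bic1 w)^*) (- (bic2 w)^*).

Definition hyp_nonneg w : Prop :=
  exists x1 x2 : R, [/\ 0 <= x1, 0 <= x2
    & w = bic_e1 * bic_of_real x1 + bic_e2 * bic_of_real x2].

Lemma bicE w :
  w = bic_of_complex (bic1 w) + bic_of_complex (bic2 w) * bic_i2.
Proof. by apply: bic_ext => /=; ring. Qed.

Lemma bic_i1_sqr : bic_i1 * bic_i1 = -1.
Proof.
by apply: bic_ext; apply/eqP; rewrite eq_complex /=; apply/andP; split;
  apply/eqP; ring.
Qed.

Lemma bic_i2_sqr : bic_i2 * bic_i2 = -1.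
Proof. by apply: bic_ext => /=; ring. Qed.

Lemma bic_j_sqr : bic_j * bic_j = 1.
Proof. by rewrite /bic_j mulrACA bic_i1_sqr bic_i2_sqr mulrNN mulr1. Qed.

Lemma bic_halfD : bic_of_real 2^-1 + bic_of_real 2^-1 = 1.
Proof.
apply: bic_ext; apply/eqP; rewrite eq_complex /=; apply/andP; split;
  apply/eqP; by field.
Qed.

Lemma bic_e1De2 : bic_e1 + bic_e2 = 1.
Proof.
rewrite /bic_e1 /bic_e2 -mulrDr addrACA subrr addr0 mulrDr mulr1.
exact: bic_halfD.
Qed.

Lemma bic_e1Me2 : bic_e1 * bic_e2 = 0.
Proof.
rewrite /bic_e1 /bic_e2 mulrACA [X in _ * X](_ : _ = 0) ?mulr0 //.
by rewrite mulrBr mulr1 mulrDl mul1r bic_j_sqr [bic_j + 1]addrC subrr.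
Qed.

End BicomplexRing.

Section BicomplexModule.
Variables (R : realType) (M : lmodType (bicomplex R)).
Local Notation T := (bicomplex R).

Definition generating n (b : 'I_n -> M) : Prop :=
  forall psi : M, exists c : 'I_n -> T, psi = \sum_(i < n) c i *: b i.

Definition lin_independent n (b : 'I_n -> M) : Prop :=
  forall c : 'I_n -> T, \sum_(i < n) c i *: b i = 0 -> forall i, c i = 0.

Definition is_basis n (b : 'I_n -> M) : Prop :=
  generating b /\ lin_independent b.

Definition free_of_dim (n : nat) : Prop := exists b : 'I_n -> M, is_basis b.

Definition null_cone (psi : M) : Prop :=
  bic_e1 R *: psi = 0 \/ bic_e2 R *: psi = 0.

Record scalar_product (s : M -> M -> T) : Prop := ScalarProduct {
  sp_add : forall psi phi chi, s psi (phi + chi) = s psi phi + s psi chi;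
  sp_scale : forall psi (a : T) phi, s psi (a *: phi) = a * s psi phi;
  sp_herm : forall psi phi, s psi phi = dag3 (s phi psi);
  sp_def : forall psi, s psi psi = 0 <-> psi = 0
}.

Definition hyperbolic_positive (s : M -> M -> T) : Prop :=
  forall psi, hyp_nonneg (s psi psi).

Definition ketbra (s : M -> M -> T) (phi psi : M) : M -> M :=
  fun chi => s psi chi *: phi.

Definition orthonormal_kets (s : M -> M -> T) n (phi : 'I_n -> M) : Prop :=
  forall l p, s (phi l) (phi p) = (l == p)%:R.

Definition is_adjoint (s : M -> M -> T) (A B : {linear M -> M}) : Prop :=
  forall psi phi, s psi (A phi) = s (B psi) phi.

(* [is_adjoint s A] determines the adjoint, so that "H^* = H" is the assertion
   that H itself is an adjoint of H. *)
Lemma is_adjoint_uniq (s : M -> M -> T) (A B C : {linear M -> M}) :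
  scalar_product s -> is_adjoint s A B -> is_adjoint s A C -> B =1 C.
Proof.
move=> [sD sZ sH s0] hB hC psi; apply/eqP; rewrite -subr_eq0; apply/eqP/s0.
rewrite -[X in s _ (_ + X)]scaleN1r sD sZ mulN1r.
by rewrite [s _ (B _)]sH [s _ (C _)]sH -hB -hC subrr.
Qed.

Definition self_adjoint (s : M -> M -> T) (H : {linear M -> M}) : Prop :=
  is_adjoint s H H.

Definition eigenket (A : {linear M -> M}) (lambda : T) (psi : M) : Prop :=
  ~ null_cone psi /\ A psi = lambda *: psi.

End BicomplexModule.

(* Main.v *)
Require Import Defs.
From mathcomp Require Import all_boot all_order all_algebra.
From mathcomp Require Import reals.
From HB Require Import structures.
From mathcomp Require Import complex ring spectral sesquilinear.
Import Order.TTheory GRing.Theory Num.Theory.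
Local Open Scope ring_scope.
Local Open Scope sesquilinear_scope.

Set Implicit Arguments.
Unset Strict Implicit.
Unset Printing Implicit Defensive.

(** The two idempotent components [w |-> w_1] and [w |-> w_2] are ring
    morphisms from the bicomplex numbers onto the complex numbers which turn
    [dag3] into complex conjugation, and jointly they are bijective.  In a
    basis of [M], the scalar product and [H] are given by a Gram matrix [G] and
    a matrix [A]; in each component [G] becomes Hermitian positive definite and
    [A] becomes self-adjoint for [G].  The complex spectral theorem diagonalises
    each component in a [G]-orthonormal basis, and gluing the two transition
    matrices gives the required kets. *)

(** * Spectral theorem over a closed numeric field, relative to a positive definite Gram matrix *)

Section ComplexSpectral.
Variables (C : numClosedFieldType) (n : nat).
Implicit Types (G A : 'M[C]_n).

Lemma trmxC_mul m p q (A : 'M[C]_(m, p)) (B : 'M[C]_(p, q)) :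
  (A *m B)^t* = B^t* *m A^t*.
Proof. by rewrite trmx_mul map_mxM. Qed.

(** A Hermitian matrix is normal, so the spectral theorem for normal matrices applies. *)
Lemma hermitian_diagonalization A : A^t* = A ->
  exists (U : 'M[C]_n) (d : 'rV[C]_n),
    U \is unitarymx /\ A = U^t* *m diag_mx d *m U.
Proof.
move=> hA; exists (spectralmx A), (spectral_diag A).
split; first exact: spectral_unitarymx.
rewrite -invmx_unitary ?spectral_unitarymx //.
apply/orthomx_spectralP/hermitian_normalmx.
by apply/is_hermitianmxP; rewrite expr0 scale1r hA.
Qed.

Definition posdefmx G :=
  forall v : 'cV[C]_n, v != 0 -> 0 < (v^t* *m G *m v) 0 0.

(** With [G = U^* D U], the matrix [Q = U^* D^(-1/2)] works, once the entries of [D] are known to be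
    positive. *)
Lemma posdef_orthonormal G : G^t* = G -> posdefmx G ->
  exists Q : 'M[C]_n, Q^t* *m G *m Q = 1%:M.
Proof.
move=> hG pG; have [U [d [uU eG]]] := hermitian_diagonalization hG.
have UU : U *m U^t* = 1%:M by exact/unitarymxP.
(* The form of [G] evaluated at [U^* e_i] equals the [i]-th diagonal entry. *)
have d_gt0 i : 0 < d 0 i.
  pose e : 'cV[C]_n := delta_mx i 0.
  have eC : e^t* = delta_mx 0 i by rewrite /e trmx_delta map_delta_mx.
  have e_neq0 : U^t* *m e != 0.
    apply/eqP => /(congr1 (mulmx U)) /matrixP /(_ i 0) /eqP.
    by rewrite mulmxA UU mul1mx mulmx0 !mxE !eqxx oner_eq0.
  have := pG _ e_neq0; rewrite eG trmxC_mul trmxCK !mulmxA.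
  rewrite mulmxtVK // -!mulmxA (mulmxA U) UU mul1mx mulmxA eC -rowE.
  by rewrite -colE !mxE eqxx.
pose r := \row_i (sqrtC (d 0 i))^-1.
have rC : (diag_mx r)^t* = diag_mx r.
  rewrite tr_diag_mx map_diag_mx; congr diag_mx; apply/rowP => i; rewrite !mxE.
  by apply/CrealP; rewrite realV ger0_real // sqrtC_ge0 ltW.
exists (U^t* *m diag_mx r); rewrite trmxC_mul trmxCK rC eG !mulmxA.
rewrite mulmxtVK // -!mulmxA (mulmxA U) UU mul1mx.
rewrite !mulmx_diag -diag_const_mx; congr diag_mx; apply/rowP => i.
rewrite !mxE mulrC -mulrA -invfM -expr2 sqrtCK divff //.
by rewrite gt_eqF.
Qed.

(** In the [G]-orthonormal columns of [Q], the matrix [A] becomes the Hermitian [B = Q^* G A Q]. A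
    unitary diagonalisation of [B] by [V] yields [P = Q V^*]. *)
Lemma posdef_spectral G A : G^t* = G -> posdefmx G -> A^t* *m G = G *m A ->
  exists (P : 'M[C]_n) (d : 'rV[C]_n),
    P^t* *m G *m P = 1%:M /\ A *m P = P *m diag_mx d.
Proof.
move=> hG pG hA; have [Q QGQ] := posdef_orthonormal hG pG.
pose B := Q^t* *m G *m A *m Q.
have hB : B^t* = B.
  by rewrite /B !trmxC_mul trmxCK hG -!mulmxA (mulmxA _ G) hA !mulmxA.
have [V [d [uV eB]]] := hermitian_diagonalization hB.
have VV : V *m V^t* = 1%:M by exact/unitarymxP.
exists (Q *m V^t*), d; split.
  by rewrite trmxC_mul trmxCK -!mulmxA (mulmxA G) (mulmxA (Q^t*)) (mulmxA (Q^t*))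
    QGQ mul1mx.
(* For square matrices the left inverse [Q^* G] of [Q] is also a right inverse. *)
have QB : A *m Q = Q *m B.
  by rewrite /B !mulmxA -(mulmxA Q) (mulmx1C QGQ) mul1mx.
by rewrite mulmxA QB eB -!mulmxA VV mulmx1.
Qed.

End ComplexSpectral.

(** * Idempotent components of bicomplex numbers and matrices *)

Section IdempotentComponents.
Local Open Scope complex_scope.
Variable R : realType.
Local Notation T := (bicomplex R).
Implicit Types (b : bool) (u v w : T).

(* [bic_hat true] and [bic_hat false] are the components along e1 and e2. *)
Definition bic_hat b w : R[i] := bic1 w - (-1) ^+ (~~ b) * 'i * bic2 w.

(** Inverse of the pair of components: it solves [z1 - i z2 = f true] and [z1 + i z2 = f false] for
    [z1] and [z2]. *)
Definition bic_glue (f : bool -> R[i]) : T :=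
  Bicomplex ((f true + f false) / 2) ('i * (f true - f false) / 2).

Lemma sqr_imaginary : 'i * 'i = -1 :> R[i].
Proof. by rewrite -expr2 sqr_i. Qed.

Lemma bic_hat_is_additive b : additive (bic_hat b).
Proof. by move=> u v; rewrite /bic_hat /=; ring. Qed.

Lemma bic_hat_is_multiplicative b : multiplicative (bic_hat b).
Proof.
split=> [u v|]; last by rewrite /bic_hat /=; ring.
rewrite /bic_hat /=.
(* Writing the minus sign as ['i * 'i] leaves an identity that is polynomial in ['i], within reach
   of [ring]. *)
have -> : bic1 u * bic1 v - bic2 u * bic2 v =
  bic1 u * bic1 v + ('i * 'i) * bic2 u * bic2 v.
  by rewrite sqr_imaginary; ring.
by case: b => /=; ring.
Qed.

HB.instance Definition _ b :=
  GRing.isAdditive.Build T R[i] (bic_hat b) (bic_hat_is_additive b).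
HB.instance Definition _ b :=
  GRing.isMultiplicative.Build T R[i] (bic_hat b) (bic_hat_is_multiplicative b).

Lemma bic_glueK f b : bic_hat b (bic_glue f) = f b.
Proof.
rewrite /bic_hat /bic_glue /= !mulrA -(mulrA _ 'i 'i) sqr_imaginary.
by case: b => /=; field.
Qed.

Lemma bic_hatK w : bic_glue (bic_hat^~ w) = w.
Proof.
apply: bic_ext; rewrite /bic_glue /bic_hat /=; first by field.
have -> : 'i * (bic1 w - 1 * 'i * bic2 w - (bic1 w - -1 * 'i * bic2 w)) =
  - ('i * 'i) * (2 * bic2 w) by ring.
by rewrite sqr_imaginary; field.
Qed.

Lemma bic_hat_inj u v : (forall b, bic_hat b u = bic_hat b v) -> u = v.
Proof.
by move=> e; rewrite -(bic_hatK u) -(bic_hatK v) /bic_glue !e.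
Qed.

Lemma bic_hat_dag3 b w : bic_hat b (dag3 w) = (bic_hat b w)^*.
Proof.
rewrite /bic_hat rmorphB !rmorphM rmorph_sign /=.
have -> : 0 -i* 1 = - 'i :> R[i] by apply/eqP; rewrite eq_complex /= oppr0 !eqxx.
by ring.
Qed.

Lemma bic_hat_real b x : bic_hat b (bic_of_real x) = x%:C.
Proof. by rewrite /bic_hat /= mulr0 subr0. Qed.

Lemma bic_hat_j b : bic_hat b (bic_j R) = (-1) ^+ (~~ b).
Proof.
have hi1 : bic_hat b (bic_i1 R) = 'i by rewrite /bic_hat mulr0 subr0.
have hi2 : bic_hat b (bic_i2 R) = - ((-1) ^+ (~~ b) * 'i).
  by rewrite /bic_hat mulr1 sub0r.
by rewrite rmorphM /= hi1 hi2 mulrN mulrCA sqr_imaginary mulrN1 opprK.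
Qed.

Lemma bic_hat_e1 b : bic_hat b (bic_e1 R) = b%:R.
Proof.
rewrite rmorphM rmorphD rmorph1 /= bic_hat_real bic_hat_j fmorphV rmorph_nat.
by case: b => /=; field.
Qed.

Lemma bic_hat_e2 b : bic_hat b (bic_e2 R) = (~~ b)%:R.
Proof.
rewrite rmorphM rmorphB rmorph1 /= bic_hat_real bic_hat_j fmorphV rmorph_nat.
by case: b => /=; field.
Qed.

Lemma hyp_nonneg_hat b w : hyp_nonneg w -> 0 <= bic_hat b w.
Proof.
move=> [x1 [x2 [x1_ge0 x2_ge0 ->]]].
rewrite rmorphD (rmorphM _ (bic_e1 R)) (rmorphM _ (bic_e2 R)) /=.
rewrite bic_hat_e1 bic_hat_e2 !bic_hat_real.
by case: b; rewrite !(mul1r, mul0r, addr0, add0r) lecR.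
Qed.

Lemma dag3_is_additive : additive (@dag3 R).
Proof.
move=> u v; apply: bic_hat_inj => b.
by rewrite bic_hat_dag3 !(rmorphB (bic_hat b)) (rmorphB conjc) /= !bic_hat_dag3.
Qed.

HB.instance Definition _ :=
  GRing.isAdditive.Build T T (@dag3 R) dag3_is_additive.

Lemma dag3M u v : dag3 (u * v) = dag3 u * dag3 v.
Proof.
apply: bic_hat_inj => b.
by rewrite bic_hat_dag3 !(rmorphM (bic_hat b)) (rmorphM conjc) /= !bic_hat_dag3.
Qed.

Definition dagmx m p (A : 'M[T]_(m, p)) : 'M[T]_(p, m) := map_mx (@dag3 R) A^T.

Lemma map_dagmx b m p (A : 'M[T]_(m, p)) :
  map_mx (bic_hat b) (dagmx A) = (map_mx (bic_hat b) A)^t*.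
Proof. by apply/matrixP => i j; rewrite !mxE bic_hat_dag3. Qed.

Lemma map_hat_inj m p (A B : 'M[T]_(m, p)) :
  (forall b, map_mx (bic_hat b) A = map_mx (bic_hat b) B) -> A = B.
Proof.
move=> e; apply/matrixP => i j; apply: bic_hat_inj => b.
by have /matrixP/(_ i j) := e b; rewrite !mxE.
Qed.

Lemma dagmx1 n : dagmx 1%:M = 1%:M :> 'M[T]_n.
Proof.
by apply: map_hat_inj => b; rewrite map_dagmx map_scalar_mx rmorph1 trmx1 map_mx1.
Qed.

Definition gluemx m p (F : bool -> 'M[R[i]]_(m, p)) : 'M[T]_(m, p) :=
  \matrix_(i, j) bic_glue (fun b => F b i j).

Lemma gluemxK m p (F : bool -> 'M[R[i]]_(m, p)) b :
  map_mx (bic_hat b) (gluemx F) = F b.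
Proof. by apply/matrixP => i j; rewrite !mxE bic_glueK. Qed.

(** Both hypotheses on products and conjugates pass to each component, where [posdef_spectral]
    applies; the two solutions are glued and the equations checked componentwise. *)
Lemma bicomplex_spectral n (G A : 'M[T]_n) :
    dagmx G = G -> (forall b, posdefmx (map_mx (bic_hat b) G)) ->
    dagmx A *m G = G *m A ->
  exists (P : 'M[T]_n) (d : 'rV[T]_n),
    dagmx P *m G *m P = 1%:M /\ A *m P = P *m diag_mx d.
Proof.
move=> hG pG hA.
have hGb b : (map_mx (bic_hat b) G)^t* = map_mx (bic_hat b) G.
  by rewrite -map_dagmx hG.
have hAb b : (map_mx (bic_hat b) A)^t* *m map_mx (bic_hat b) G =
    map_mx (bic_hat b) G *m map_mx (bic_hat b) A.
  by rewrite -map_dagmx -!map_mxM hA.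
have [P1 [d1 [PGP1 AP1]]] := posdef_spectral (hGb true) (pG true) (hAb true).
have [P2 [d2 [PGP2 AP2]]] :=
  posdef_spectral (hGb false) (pG false) (hAb false).
exists (gluemx (fun b => if b then P1 else P2)).
exists (gluemx (fun b => if b then d1 else d2)).
split; apply: map_hat_inj => b.
  by rewrite !map_mxM map_dagmx gluemxK map_scalar_mx rmorph1; case: b.
by rewrite !map_mxM map_diag_mx !gluemxK; case: b.
Qed.

End IdempotentComponents.

(** * Kets in coordinates and Gram matrices *)

Section Kets.
Variables (R : realType) (M : lmodType (bicomplex R)).
Variable s : M -> M -> bicomplex R.
Hypothesis s_sp : scalar_product s.
Local Notation T := (bicomplex R).

Lemma sp_sumr n psi (c : 'I_n -> T) (f : 'I_n -> M) :
  s psi (\sum_i c i *: f i) = \sum_i c i * s psi (f i).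
Proof.
have s0 : s psi 0 = 0 by rewrite -(scale0r 0) sp_scale // mul0r.
rewrite (big_morph (s psi) (sp_add s_sp psi) s0).
by apply: eq_bigr => i _; rewrite sp_scale.
Qed.

Lemma sp_suml n psi (c : 'I_n -> T) (f : 'I_n -> M) :
  s (\sum_i c i *: f i) psi = \sum_i dag3 (c i) * s (f i) psi.
Proof.
rewrite sp_herm // sp_sumr raddf_sum; apply: eq_bigr => i _.
by rewrite /= dag3M -sp_herm.
Qed.

(** The columns of [P] are coordinate vectors with respect to [f], so a change of basis becomes a
    matrix product. *)
Definition ketmx n (f : 'I_n -> M) k (P : 'M[T]_(n, k)) (l : 'I_k) : M :=
  \sum_i P i l *: f i.

Definition gram n (f : 'I_n -> M) : 'M[T]_n := \matrix_(i, j) s (f i) (f j).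

Lemma ketmx1 n (f : 'I_n -> M) i : ketmx f 1%:M i = f i.
Proof.
rewrite /ketmx (bigD1 i) //= big1 => [|j ji]; rewrite mxE ?eqxx ?scale1r ?addr0 //.
by rewrite (negPf ji) scale0r.
Qed.

Lemma ketmxM n (f : 'I_n -> M) k m (P : 'M_(n, k)) (Q : 'M_(k, m)) l :
  ketmx f (P *m Q) l = \sum_i Q i l *: ketmx f P i.
Proof.
under [RHS]eq_bigr do rewrite scaler_sumr.
rewrite exchange_big; apply: eq_bigr => i _ /=.
rewrite mxE scaler_suml; apply: eq_bigr => j _.
by rewrite scalerA mulrC.
Qed.

Lemma sp_ketmx n (f : 'I_n -> M) k m (P : 'M_(n, k)) (Q : 'M_(n, m)) l p :
  s (ketmx f P l) (ketmx f Q p) = (dagmx P *m gram f *m Q) l p.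
Proof.
rewrite sp_sumr mxE; apply: eq_bigr => j _; rewrite sp_suml mulrC; congr (_ * _).
by rewrite mxE; apply: eq_bigr => i _; rewrite !mxE.
Qed.

Lemma gram_herm n (f : 'I_n -> M) : dagmx (gram f) = gram f.
Proof. by apply/matrixP => i j; rewrite !mxE -sp_herm. Qed.

(** Hyperbolic positivity gives only a nonnegative form in each component. Strictness comes from
    definiteness of [s] and independence of [f], applied to a ket supported in component [b]. *)
Lemma gram_posdef n (f : 'I_n -> M) b :
    hyperbolic_positive s -> lin_independent f ->
  posdefmx (map_mx (bic_hat b) (gram f)).
Proof.
move=> s_pos f_free v v_neq0.
(* Extending [v] by zero in the other component makes the whole scalar square vanish as soon as its
   component [b] does. *)
pose c := gluemx (fun b' => if b' == b then v else 0).
have s_hat b' : bic_hat b' (s (ketmx f c 0) (ketmx f c 0)) =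
    if b' == b then (v^t* *m map_mx (bic_hat b) (gram f) *m v) 0 0 else 0.
  rewrite sp_ketmx; set X := _ *m c.
  have -> : bic_hat b' (X 0 0) = map_mx (bic_hat b') X 0 0 by rewrite [RHS]mxE.
  rewrite !map_mxM map_dagmx gluemxK; case: eqP => [->//|_].
  by rewrite mulmx0 mxE.
rewrite lt_def; apply/andP; split; last first.
  by have := hyp_nonneg_hat b (s_pos (ketmx f c 0)); rewrite s_hat eqxx.
apply: contra_neq v_neq0 => q0; have /(sp_def s_sp)/f_free c0 :
    s (ketmx f c 0) (ketmx f c 0) = 0.
  by apply: bic_hat_inj => b'; rewrite s_hat q0 if_same rmorph0.
have -> : v = map_mx (bic_hat b) c by rewrite gluemxK eqxx.
by apply/colP => i; rewrite [LHS]mxE c0 rmorph0 mxE.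
Qed.

Lemma orthonormal_coord n (phi : 'I_n -> M) (c : 'I_n -> T) p :
  orthonormal_kets s phi -> s (phi p) (\sum_l c l *: phi l) = c p.
Proof.
move=> phi_on; rewrite sp_sumr (bigD1 p) //= phi_on eqxx mulr1 big1 ?addr0 //.
by move=> l lp; rewrite phi_on eq_sym (negPf lp) mulr0.
Qed.

(** Pairing [e_k psi = 0] with [psi] would give [e_k = 0], yet each idempotent has a component equal
    to 1. *)
Lemma unit_ket_not_null psi : s psi psi = 1 -> ~ null_cone psi.
Proof.
move=> psi1 []/(congr1 (s psi)); rewrite sp_scale // psi1 mulr1;
  rewrite -(scale0r psi) sp_scale // mul0r.
- by move=> /(congr1 (bic_hat true))/eqP; rewrite bic_hat_e1 rmorph0 oner_eq0.
- by move=> /(congr1 (bic_hat false))/eqP; rewrite bic_hat_e2 rmorph0 oner_eq0.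
Qed.

Lemma linear_ketmx (H : {linear M -> M}) n (f : 'I_n -> M) (A : 'M_n) :
    (forall j, H (f j) = ketmx f A j) ->
  forall k (P : 'M_(n, k)) l, H (ketmx f P l) = ketmx f (A *m P) l.
Proof.
move=> HA k P l; rewrite ketmxM linear_sum; apply: eq_bigr => i _.
by rewrite linearZ /= HA.
Qed.

End Kets.

(** * Spectral decomposition of a self-adjoint operator *)

Unset Implicit Arguments.

Theorem theorem4p15 (R : realType) (M : lmodType (bicomplex R)) (n : nat)
    (s : M -> M -> bicomplex R) (H : {linear M -> M}) :
  free_of_dim M n ->
  scalar_product s ->
  hyperbolic_positive s ->
  self_adjoint s H ->
  exists (phi : 'I_n -> M) (lambda : 'I_n -> bicomplex R),
    [/\ is_basis phi,
        orthonormal_kets s phi,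
        forall l, eigenket H (lambda l) (phi l)
      & forall chi, H chi = \sum_(l < n) lambda l *: ketbra s (phi l) (phi l) chi].
Proof.
move=> [f [f_gen f_free]] s_sp s_pos H_sa.
have coord psi : exists c : 'cV_n, psi = ketmx f c 0.
  have [c ->] := f_gen psi; exists (\col_i c i).
  by apply: eq_bigr => i _; rewrite mxE.
have [a Ha] := fin_all_exists (fun j => coord (H (f j))).
pose A := \matrix_(i, j) a j i 0.
have HA j : H (f j) = ketmx f A j.
  by rewrite Ha; apply: eq_bigr => i _; rewrite mxE.
pose G := gram s f.
(* Self-adjointness, tested on pairs of basis kets, is this matrix identity. *)
have AG : dagmx A *m G = G *m A.
  apply/matrixP => i j; have := H_sa (f i) (f j); rewrite !HA.
  rewrite -(ketmx1 f i) -(ketmx1 f j) !sp_ketmx //.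
  by rewrite dagmx1 mul1mx mulmx1.
have [P [d [PGP AP]]] := bicomplex_spectral (gram_herm s_sp f)
  (fun b => gram_posdef s_sp b s_pos f_free) AG.
pose phi := ketmx f P.
have phi_on : orthonormal_kets s phi.
  by move=> l p; rewrite sp_ketmx // PGP mxE.
(* Since [P^* G] is a two-sided inverse of [P], the new coordinates of [f c] are [P^* G c]. *)
have phi_gen : generating phi.
  move=> psi; have [c ->] := coord psi.
  exists (fun l => (dagmx P *m G *m c) l 0).
  by rewrite -ketmxM mulmxA (mulmx1C PGP) mul1mx.
have H_phi l : H (phi l) = d 0 l *: phi l.
  rewrite (linear_ketmx HA) AP ketmxM (bigD1 l) //= big1 ?addr0.
    by rewrite mxE eqxx.
  by move=> i il; rewrite mxE (negPf il) scale0r.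
exists phi, (d 0); split=> //.
(* Independence: pairing a vanishing combination with [phi p] isolates the coefficient [c p]. *)
- split=> // c c0 p; rewrite -(orthonormal_coord s_sp c p phi_on) c0.
  by rewrite -(scale0r 0) sp_scale // mul0r.
- by move=> l; split=> //; apply: (unit_ket_not_null s_sp); rewrite phi_on eqxx.
move=> chi; have [c ->] := phi_gen chi.
rewrite linear_sum; apply: eq_bigr => l _.
by rewrite /ketbra (orthonormal_coord s_sp) // linearZ /= H_phi !scalerA mulrC.
Qed.
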